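(* (i) If $\Gamma$ is a directed acyclic graph (with arbitrary real edge weights), then $\mathrm{spec}(\Delta)\subseteq\{0,1\}$. Furthermore, the multiplicity of the eigenvalue $0$ of $\Delta$ is $m_0(\Delta)=|V\setminus V_R|$ and the multiplicity of the eigenvalue $1$ of $\Delta$ is $m_1(\Delta)=|V_R|$. (ii) For a graph $\Gamma$: $\Gamma$ has only nonnegative weights and $\mathrm{spec}(\Delta)\subseteq\{0,1\}$ if and only if $\Gamma$ is a directed acyclic graph with nonnegative weights.
   Context: A graph $\Gamma=(V,E,w)$ is a finite weighted directed graph without loops and multiple edges; $w:V\times V\to\mathbb{R}$ is the weight function, $w_{ij}$ is the weight of the directed edge from $j$ to $i$, and $w_{ij}=0$ if and only if there is no edge from $j$ to $i$ (in particular $w_{ii}=0$). Weights may be positive or negative. The in-degree of $i$ is $d_i^{\mathrm{in}}=\sum_j w_{ij}$. $V_R:=\{i\in V: d_i^{\mathrm{in}}\neq 0\}$. $C(V)$ is the space of complex valued functions on $V$. The normalized Laplace operator $\Delta:C(V)\to C(V)$ is defined by $\Delta v(i)=v(i)-\frac{1}{d_i^{\mathrm{in}}}\sum_j w_{ij}v(j)$ if $d_i^{\mathrm{in}}\neq 0$ and $\Delta v(i)=0$ otherwise. Multiplicities are algebraic multiplicities. A directed cycle is a cycle with all edges oriented in the same direction (two mutually opposite edges between two vertices count as a directed cycle). A vertex is cyclic if it is contained in at least one directed cycle. A graph is a directed acyclic graph if none of its vertices is cyclic. *)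

(* Defs.v *)
From HB Require Import structures.
From mathcomp Require Import all_boot all_order all_algebra.
From mathcomp Require Import reals complex.

Set Implicit Arguments.
Unset Strict Implicit.
Unset Printing Implicit Defensive.

Import GRing.Theory passmx.
Local Open Scope ring_scope.
Local Open Scope complex_scope.

(* [weight G i j] is the weight of the edge from j to i, and there is such an
   edge exactly when that weight is nonzero, so the edge set is not a separate
   field. *)
Record wdigraph (R : realType) (V : finType) := WDigraph {
  weight : V -> V -> R;
  weight_irrefl : forall i, weight i i = 0 }.

Section Graph.
Variables (R : realType) (V : finType) (G : wdigraph R V).

Definition edge : rel V := fun j i => weight G i j != 0.

(* A directed cycle is a nonempty duplicate-free sequence of vertices whose
   cyclically consecutive vertices are joined by edges; without loops, it has at
   least two vertices, and [:: i; j] is one when i and j are joined both ways. *)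
Definition cyclic_vertex (i : V) : Prop := exists2 c, ucycle edge c & i \in c.

Definition directed_acyclic : Prop := forall i, ~ cyclic_vertex i.

Definition nonneg_weights : Prop := forall i j, 0 <= weight G i j.

Definition indeg (i : V) : R := \sum_j weight G i j.

Definition VR : {set V} := [set i | indeg i != 0].

Definition laplace_fun (v : {ffun V -> R[i]^o}) : {ffun V -> R[i]^o} :=
  [ffun i => if indeg i != 0
             then v i - (indeg i)^-1%:C * \sum_j (weight G i j)%:C * v j
             else 0].

Fact laplace_fun_linear : linear laplace_fun.
Proof.
move=> a u v; apply/ffunP=> i; rewrite !ffunE; case: ifP => _; last first.
  by rewrite scaler0 addr0.
have -> : \sum_j (weight G i j)%:C * (a *: u + v) j =
    a * (\sum_j (weight G i j)%:C * u j) + \sum_j (weight G i j)%:C * v j.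
  rewrite mulr_sumr -big_split; apply: eq_bigr => j _.
  by rewrite !ffunE mulrDr /GRing.scale /= mulrCA.
by rewrite scalerBr addrACA -opprD mulrDr mulrCA.
Qed.

HB.instance Definition _ := GRing.isLinear.Build
  R[i] {ffun V -> R[i]^o} {ffun V -> R[i]^o} _ laplace_fun laplace_fun_linear.

Definition laplacian : 'End({ffun V -> R[i]^o}) := linfun laplace_fun.

End Graph.

Section Spectrum.
Variables (F : fieldType) (U : vectType F) (f : 'End(U)).

Definition spec : pred F := leigenvalue f.

(* The choice of the basis is irrelevant, since matrices of f in different bases
   are similar. *)
Definition end_char_poly : {poly F} :=
  char_poly (mxof (vbasis {:U}) (vbasis {:U}) f).

Definition alg_mult (a : F) : nat := mup a end_char_poly.

End Spectrum.

(* Main.v *)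
Require Import Defs.
From mathcomp Require Import all_boot all_order all_algebra.
From mathcomp Require Import fingroup perm.
From mathcomp Require Import reals complex.

Set Implicit Arguments.
Unset Strict Implicit.
Unset Printing Implicit Defensive.

Import Order.TTheory GRing.Theory Num.Theory passmx.
Local Open Scope ring_scope.

(** Everything is read off the matrix of the Laplacian in the basis of vertex
indicators. This matrix is D - P, where D is the diagonal 0/1 matrix of the set
VR and P holds the normalized weights (indeg j)^-1 * w_ji; the support of P
consists of edges, and P has zero diagonal since there are no loops.

If the graph is acyclic, only the identity permutation contributes to the
Leibniz formula for the characteristic polynomial: a permutation moving a point
has a nontrivial orbit, and if its term were nonzero this orbit would be a
directed cycle (char_poly_acyclic). Hence the characteristic polynomial is the
product of the 'X - D_ii, that is 'X^(number of vertices outside VR) times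
('X - 1)^#|VR|, which gives the spectrum and both multiplicities.

Conversely, suppose that the weights are nonnegative and that the spectrum of
the Laplacian is contained in {0, 1}. An eigenvector of P for a nonzero
eigenvalue mu is supported in VR, where D acts as the identity, so 1 - mu is an
eigenvalue of the Laplacian (eigenvalue_transition_mx) and mu = 1. All
eigenvalues of P are thus nonnegative, but they add up to the trace of P, which
is 0: they all vanish and P is nilpotent by Cayley-Hamilton
(trace0_nilpotent). A nonnegative matrix with a cycle in its support is never
nilpotent, because mass placed on the cycle can be pushed around it forever
(nonneg_trace0_acyclic). So there is no directed cycle. *)

(** * Characteristic polynomials of endomorphisms *)

Lemma char_poly_similar (F : comNzRingType) m n (A : 'M[F]_m)
    (S : 'M_(n, m)) (T : 'M_(m, n)) :
  T *m S = 1%:M -> S *m T = 1%:M -> char_poly (S *m A *m T) = char_poly A.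
Proof.
move=> TS ST.
have emn : m = n.
  by apply/eqP; rewrite eqn_leq (mulmx1_min TS) (mulmx1_min ST).
case: n / emn S T TS ST => S T TS ST; rewrite /char_poly.
pose up : 'M_m -> 'M_m := map_mx (@polyC F).
have upTS : up T *m up S = 1%:M by rewrite -map_mxM TS map_mx1.
have upST : up S *m up T = 1%:M by rewrite -map_mxM ST map_mx1.
have -> : char_poly_mx (S *m A *m T) = up S *m char_poly_mx A *m up T.
  rewrite /char_poly_mx mulmxBr mulmxBl !map_mxM; congr (_ - _).
  by rewrite scalar_mxC -mulmxA upST mulmx1.
by rewrite !det_mulmx mulrAC -det_mulmx upST det1 mul1r.
Qed.

Section StandardBasis.
Variables (F : fieldType) (V : finType).
Implicit Type f : 'End({ffun V -> F^o}).

Definition unit_ffun (j : V) : {ffun V -> F^o} := [ffun i => (i == j)%:R].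

(** Endomorphisms act on row vectors, as in mxof: row i lists the values of the
image of the indicator of vertex i. *)
Definition std_mx f : 'M[F]_#|V| :=
  \matrix_(i, j) f (unit_ffun (enum_val i)) (enum_val j).

Lemma ffun_unit_sum (v : {ffun V -> F^o}) :
  v = \sum_(i < #|V|) v (enum_val i) *: unit_ffun (enum_val i).
Proof.
apply/ffunP=> x; rewrite sum_ffunE.
rewrite (bigD1 (enum_rank x)) //= big1 => [|i ix].
  by rewrite !ffunE enum_rankK eqxx addr0 /GRing.scale /= mulr1.
rewrite !ffunE; case: eqP => [xi|_]; last by rewrite scaler0.
by rewrite xi enum_valK eqxx in ix.
Qed.

(** The change-of-basis matrices T and S between the indicators and the abstract
basis are mutually inverse, but their formats involve #|V| and the dimension of
the function space, which are equal without being convertible; hence the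
rectangular form of char_poly_similar. *)
Lemma end_char_poly_std f : end_char_poly f = char_poly (std_mx f).
Proof.
set b := vbasis {:{ffun V -> F^o}}.
have bb : basis_of fullv b := vbasisP _.
pose T : 'M[F]_(#|V|, _) := \matrix_i rVof b (unit_ffun (enum_val i)).
pose S : 'M[F]_(\dim {:{ffun V -> F^o}}, #|V|) :=
  \matrix_(k, i) (b`_k : {ffun V -> F^o}) (enum_val i).
have rVofT v : rVof b v = (\row_i v (enum_val i)) *m T.
  rewrite {1}[v]ffun_unit_sum linear_sum mulmx_sum_row; apply: eq_bigr => i _.
  by rewrite linearZ rowK mxE.
have ST : S *m T = 1%:M.
  apply/row_matrixP => k; rewrite row_mul row1 -(rVofE bb) rVofT.
  by congr (_ *m _); apply/rowP=> i; rewrite !mxE.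
have TS : T *m S = 1%:M.
  apply/matrixP => i j; rewrite !mxE.
  have /(congr1 (fun v : {ffun V -> F^o} => v (enum_val j))) :=
    rVofK bb (unit_ffun (enum_val i)).
  rewrite sum_ffunE ffunE (inj_eq enum_val_inj) eq_sym => <-.
  by apply: eq_bigr => k _; rewrite !ffunE !mxE.
rewrite -(char_poly_similar (std_mx f) TS ST) -mulmxA; congr char_poly.
rewrite -[mxof b b f]mul1mx -ST -mulmxA; congr (_ *m _).
apply/row_matrixP => i; rewrite !row_mul rowK -rVof_app // rVofT.
by congr (_ *m _); apply/rowP=> j; rewrite !mxE.
Qed.

End StandardBasis.

Lemma spec_root (F : fieldType) (U : vectType F) (f : 'End(U)) (a : F) :
  spec f a = root (end_char_poly f) a.
Proof.
rewrite -eigenvalue_root_char; have bb : basis_of fullv _ := vbasisP {:U}.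
set b := vbasis _ in bb *.
have kerE u : (u \in lker (f - a *: \1%VF)) = (f u == a *: u).
  by rewrite memv_ker add_lfunE opp_lfunE scale_lfunE id_lfunE subr_eq0.
rewrite /spec /leigenvalue /leigenspace -vpick0.
apply/idP/eigenvalueP => [nz|[v vE nz]].
  set u := vpick _ in nz; have : u \in lker (f - a *: \1%VF) := memv_pick _.
  rewrite kerE => /eqP fu.
  by exists (rVof b u); rewrite ?rVof_eq0 // -rVof_app // fu linearZ.
rewrite vpick0; apply: contra nz => /eqP k0.
have : vecof b v \in lker (f - a *: \1%VF).
  by rewrite kerE (hom_vecof b bb) vE linearZ.
by rewrite k0 memv0 vecof_eq0.
Qed.

(** * Matrices whose support has no cycle *)

(** If a permutation s moves i and no entry M k (s k) vanishes, the orbit of i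
under s is a cycle in the off-diagonal support of M: s fixes no point of this
orbit, for otherwise it would fix i by injectivity. *)
Lemma det_acyclic (F : comNzRingType) n (M : 'M[F]_n) :
  (forall c, ucycle [rel i j | (i != j) && (M i j != 0)] c -> c = [::]) ->
  \det M = \prod_i M i i.
Proof.
move=> acyc; rewrite /determinant (bigD1 1%g) //=.
rewrite [X in _ + X]big1 ?addr0 => [|s s1].
  by rewrite odd_perm1 mul1r; apply: eq_bigr => i _; rewrite perm1.
have [i si] : exists i, s i != i.
  apply/existsP; apply: contraR s1 => /existsPn fix_s; apply/eqP/permP=> i.
  by rewrite perm1; apply/eqP; have := fix_s i; rewrite negbK.
have [/existsP[k /eqP k0] | /existsPn nz] := boolP [exists k, M k (s k) == 0].
  by rewrite (bigD1 k) //= k0 mul0r mulr0.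
have: orbit s i = [::].
  apply: acyc; rewrite /ucycle orbit_uniq andbT.
  apply: (sub_in_cycle (P := mem (orbit s i)) (e := frel s)); last 2 first.
  - exact/allP.
  - exact/cycle_orbit/perm_inj.
  move=> j k; rewrite /= -fconnect_orbit => /iter_findex ej _ /eqP <-.
  rewrite nz andbT; apply: contra si => /eqP sj; rewrite -ej -iterS iterSr in sj.
  have inj : injective (iter (findex s i j) s).
    by elim: findex => [|m IH] //= x y /perm_inj /IH.
  by rewrite eq_sym; apply/eqP/inj.
by move=> o0; have := in_orbit s i; rewrite o0.
Qed.

Lemma char_poly_acyclic (F : comNzRingType) n (A : 'M[F]_n) :
  (forall c, ucycle [rel i j | (i != j) && (A i j != 0)] c -> c = [::]) ->
  char_poly A = \prod_i ('X - (A i i)%:P).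
Proof.
move=> acyc; rewrite /char_poly det_acyclic => [|c].
  by apply: eq_bigr => i _; rewrite !mxE eqxx.
case/andP=> cyc uc; apply: acyc; rewrite /ucycle uc andbT; apply: sub_cycle cyc.
move=> i j /= /andP[ij]; rewrite !mxE (negPf ij) sub0r oppr_eq0 polyC_eq0 => ->.
by rewrite andbT.
Qed.

(** * Nonnegative matrices of trace zero *)

(** The eigenvalues are nonnegative and add up to the trace, so all of them are
zero and the characteristic polynomial is a power of 'X. *)
Lemma trace0_nilpotent (C : numClosedFieldType) n (A : 'M[C]_n.+1) :
  (forall a, eigenvalue A a -> 0 <= a) -> \tr A = 0 -> A ^+ n.+1 = 0.
Proof.
move=> ge0 tr0; have [r] := closed_field_poly_normal (char_poly A).
rewrite (monicP (char_poly_monic A)) scale1r => rE.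
have sz : size r = n.+1.
  by apply: succn_inj; rewrite -(size_char_poly A) rE size_prod_XsubC.
have r_ge0 a : a \in r -> 0 <= a.
  by rewrite -root_prod_XsubC -rE -eigenvalue_root_char; apply: ge0.
have sum0 : \sum_(a <- r) a = 0.
  apply: oppr_inj; rewrite -coefPn_prod_XsubC ?sz // -rE.
  by rewrite char_poly_trace // tr0.
have r0 a : a \in r -> a = 0.
  move=> ar; apply/eqP; move/eqP: sum0; rewrite big_seq psumr_eq0 //.
  by move/allP/(_ a ar); rewrite ar.
rewrite -(horner_mx_X A) -rmorphXn -[RHS](Cayley_Hamilton A) rE; congr horner_mx.
rewrite big_seq (eq_bigr (fun=> 'X)) => [|a /r0 ->]; last by rewrite subr0.
by rewrite -big_seq big_const_seq count_predT sz -Monoid.iteropE.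
Qed.

(** Let x be the indicator row of the vertices of a cycle. By induction on m, all
entries of x *m A ^+ m are nonnegative and those on the cycle are positive,
since each vertex of the cycle receives a positive contribution from its
predecessor. This contradicts the nilpotency of A unless the cycle is empty. *)
Lemma nonneg_trace0_acyclic (C : numClosedFieldType) n (A : 'M[C]_n) c :
  (forall i j, 0 <= A i j) -> \tr A = 0 ->
  (forall a, eigenvalue A a -> 0 <= a) ->
  path.cycle [rel i j | A i j != 0] c -> c = [::].
Proof.
case: n A c => [|n] A c A_ge0 tr0 ev_ge0 cyc; first by case: c cyc => // -[].
have nilA := trace0_nilpotent ev_ge0 tr0.
pose x : 'rV[C]_n.+1 := \row_i (i \in c)%:R.
have xA m : (forall i, 0 <= (x *m A ^+ m) 0 i) /\
    {in c, forall i, 0 < (x *m A ^+ m) 0 i}.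
  elim: m => [|m [IH0 IH]].
    by rewrite expr0 mulmx1; split=> i; rewrite mxE ?ler0n // => ->.
  have term_ge0 i j : 0 <= (x *m A ^+ m) 0 j * A j i by rewrite mulr_ge0.
  rewrite exprSr mulmxA; split=> i; rewrite mxE; first by rewrite sumr_ge0.
  move=> ic; rewrite (bigD1 (prev c i)) //= ltr_wpDr ?sumr_ge0 //.
  rewrite mulr_gt0 ?IH ?mem_prev // lt0r A_ge0 andbT.
  exact: (prev_cycle cyc ic).
case: c {cyc} @x xA => // i c x /(_ n.+1)[_ /(_ i)].
by rewrite nilA mulmx0 mxE ltxx mem_head => /(_ isT).
Qed.

(** * The Laplacian of a weighted digraph *)

Section Laplacian.
Variables (R : realType) (V : finType) (G : wdigraph R V).
Local Notation C := (R[i]%C).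
Local Notation N := (std_mx (laplacian G)).

(** The normalized weights, transposed to fit the row convention of std_mx: a
nonzero entry (i, j) is an edge from i to j. The column of a vertex outside VR
is zero because the inverse of 0 is 0. *)
Definition transition_mx : 'M[C]_#|V| := \matrix_(i, j)
  ((indeg G (enum_val j))^-1 * weight G (enum_val j) (enum_val i))%:C%C.

Lemma transition_mx_notVR i j : enum_val j \notin VR G -> transition_mx i j = 0.
Proof. by rewrite inE negbK mxE => /eqP ->; rewrite invr0 mul0r. Qed.

Lemma std_mx_laplacian i j :
  N i j = (if enum_val j \in VR G then (i == j)%:R else 0) - transition_mx i j.
Proof.
have [jR|jR] := boolP (enum_val j \in VR G); last first.
  rewrite transition_mx_notVR // subr0 mxE lfunE ffunE.
  by rewrite inE in jR; rewrite (negPf jR).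
rewrite !mxE lfunE ffunE; rewrite inE in jR; rewrite jR.
congr (_ - _); first by rewrite ffunE (inj_eq enum_val_inj) eq_sym.
rewrite rmorphM; congr (_ * _).
rewrite (bigD1 (enum_val i)) //= big1 => [|k ki]; last first.
  by rewrite ffunE (negPf ki) mulr0.
by rewrite ffunE eqxx mulr1 addr0.
Qed.

Lemma transition_mx_edge i j :
  transition_mx i j != 0 -> edge G (enum_val i) (enum_val j).
Proof.
by rewrite mxE /edge; apply: contraNneq => ->; rewrite mulr0.
Qed.

Lemma directed_acyclic_nil c :
  directed_acyclic G -> ucycle (edge G) c -> c = [::].
Proof.
case: c => // i c acyc cyc; case: (acyc i).
by exists (i :: c); rewrite ?mem_head.
Qed.

Lemma transition_mx_diag i : transition_mx i i = 0.
Proof. by rewrite mxE weight_irrefl mulr0. Qed.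

Lemma end_char_poly_laplacian : directed_acyclic G ->
  end_char_poly (laplacian G) = 'X ^+ #|~: VR G| * ('X - 1%:P) ^+ #|VR G|.
Proof.
move=> acyc; rewrite end_char_poly_std char_poly_acyclic => [|c /andP[cyc uc]].
  pose p v : {poly C} := if v \in VR G then 'X - 1%:P else 'X.
  transitivity (\prod_(i < #|V|) p (enum_val i)).
    apply: eq_bigr => i _; rewrite /p std_mx_laplacian transition_mx_diag eqxx.
    by rewrite subr0; case: ifP; rewrite ?subr0.
  rewrite -(big_enum_val p) /p.
  rewrite (bigID (mem (VR G))) /= mulrC; congr (_ * _).
    rewrite (eq_bigr (fun=> 'X)) => [|v /negPf -> //].
    by rewrite prodr_const; congr (_ ^+ _); apply: eq_card => v; rewrite inE.
  by rewrite (eq_bigr (fun=> 'X - 1%:P)) => [|v -> //]; rewrite prodr_const.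
suff /(directed_acyclic_nil acyc) : ucycle (edge G) (map enum_val c) by case: (c).
rewrite /ucycle map_inj_uniq ?uc ?andbT; last exact: enum_val_inj.
rewrite cycle_map; apply: sub_cycle cyc => i j /= /andP[/negPf ij].
rewrite std_mx_laplacian ij if_same sub0r oppr_eq0; exact: transition_mx_edge.
Qed.

(** The condition a != 0 forces the eigenvector to vanish outside VR; on the
vectors supported in VR the Laplacian is the identity minus transition_mx. *)
Lemma eigenvalue_transition_mx a : eigenvalue transition_mx a -> a != 0 ->
  spec (laplacian G) (1 - a).
Proof.
move=> /eigenvalueP[v vA nz] a0.
rewrite spec_root end_char_poly_std -eigenvalue_root_char.
apply/eigenvalueP; exists v => //.
have v_VR j : enum_val j \notin VR G -> v 0 j = 0.
  move=> jR; apply: (mulfI a0); move/rowP/(_ j): vA; rewrite !mxE mulr0 => <-.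
  by apply: big1 => i _; rewrite transition_mx_notVR ?mulr0.
pose d : 'rV[C]_#|V| := \row_j (enum_val j \in VR G)%:R.
have -> : N = diag_mx d - transition_mx.
  apply/matrixP=> i j; rewrite std_mx_laplacian !mxE; congr (_ - _).
  by case: eqP => [->|_]; case: ifP.
rewrite mulmxBr vA scalerBl scale1r mul_mx_diag; congr (_ - _).
apply/rowP=> j; rewrite !mxE.
by case: (boolP (enum_val j \in VR G)) => [_|/v_VR ->]; rewrite ?mulr1 ?mul0r.
Qed.

End Laplacian.

Theorem theorem5p1 (R : realType) (V : finType) (G : wdigraph R V) :
  (directed_acyclic G ->
     [/\ {subset spec (laplacian G) <= [:: 0; 1]},
         alg_mult (laplacian G) 0 = #|~: VR G|
       & alg_mult (laplacian G) 1 = #|VR G| ])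
  /\
  (nonneg_weights G /\ {subset spec (laplacian G) <= [:: 0; 1]}
     <-> directed_acyclic G /\ nonneg_weights G).
Proof.
have part1 : directed_acyclic G -> {subset spec (laplacian G) <= [:: 0; 1]}.
  move=> acyc a; rewrite -[_ \in spec _]/(spec (laplacian G) a) spec_root.
  rewrite end_char_poly_laplacian // rootM !rootE !horner_exp !expf_eq0.
  rewrite hornerX hornerXsubC subr_eq0 !inE.
  by case/orP=> /andP[_ ->]; rewrite ?orbT.
split=> [acyc|].
  split; first exact: part1.
  - rewrite /alg_mult end_char_poly_laplacian // mupMl; last first.
      rewrite rootE horner_exp hornerXsubC sub0r expf_eq0 oppr_eq0 oner_eq0.
      by rewrite andbF.
    by rewrite -['X]subr0 -polyC0 mup_XsubCX eqxx.
  rewrite /alg_mult end_char_poly_laplacian // mupMr ?mup_XsubCX ?eqxx //.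
  by rewrite rootE horner_exp hornerX expr1n oner_eq0.
split=> [[w_ge0 spec01]|[acyc w_ge0]]; last by split; [|exact: part1].
split=> // i [c /andP[cyc _]] ic.
suff: map enum_rank c = [::] by case: c ic {cyc}.
apply: (@nonneg_trace0_acyclic _ _ (transition_mx G)).
- move=> k j; rewrite mxE ler0c mulr_ge0 ?invr_ge0 //.
  exact: sumr_ge0.
- by apply: big1 => j _; rewrite transition_mx_diag.
- move=> a ev; have [-> //|a0] := eqVneq a 0.
  have := spec01 _ (eigenvalue_transition_mx ev a0); rewrite !inE.
  case/orP=> [|/eqP e1]; first by rewrite subr_eq0 => /eqP <-; apply: ler01.
  by rewrite -[a](subKr 1) e1 subrr.
rewrite cycle_map; apply: sub_cycle cyc => j k /= jk.
rewrite mxE !enum_rankK fmorph_eq0 mulf_neq0 // invr_neq0 //.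
(* Nonnegative weights cannot cancel: a zero in-degree leaves no incoming edge. *)
apply: contra jk; rewrite /indeg psumr_eq0 // => /allP/(_ j).
by rewrite mem_index_enum => /(_ isT).
Qed.
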